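(* There exist a problem instance (a number of agents $N$, a connected undirected graph on the agents, and continuously differentiable functions $f_1,\dots,f_N:\mathbb{R}\to\mathbb{R}$) whose average $f=\frac1N\sum_{i=1}^N f_i$ satisfies the global Lipschitz condition (GLC), and a mixing matrix $\mathbf W\in\mathbb{R}^{N\times N}$ for the graph, such that the following holds. For every constant stepsize $\alpha>0$ (no matter how small) there is an initial point $\mathbf x^0\in\mathbb{R}^{N}$ for which the DGD iteration $$\mathbf x^{r+1}=\mathbf W\mathbf x^r-\alpha^r\nabla g(\mathbf x^r),\qquad r=0,1,2,\dots,$$ with $\alpha^r=\alpha$ for all $r$, diverges to infinity. Additionally, if the constant stepsize is replaced by the diminishing stepsize $\alpha^r=\alpha/(1+r)$, then for every $\alpha>0$ there is an initial point $\mathbf x^0\in\mathbb{R}^{N}$ for which the DGD iteration still diverges to infinity.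
   Context: Decentralized problem: minimize $\frac1N\sum_{i=1}^N f_i(x_i)$ subject to $x_i=x_j$ whenever agents $i,j$ are neighbors in an undirected connected graph $G=(\mathcal V,\mathcal E)$ with $|\mathcal V|=N$; the optimization variable of each agent is a scalar ($K=1$). Write $\mathbf x=[x_1;\dots;x_N]$ and $\nabla g(\mathbf x):=[f_1'(x_1);\dots;f_N'(x_N)]\in\mathbb{R}^N$. GLC: there is a finite $L>0$ with $\|\nabla f(y)-\nabla f(z)\|\le L\|y-z\|$ for all $y,z$, where $f(u)=\frac1N\sum_{i=1}^N f_i(u)$. Mixing matrix for $G$: a symmetric $\mathbf W\in\mathbb{R}^{N\times N}$ with $\mathrm{Null}(\mathbf I_N-\mathbf W)=\mathrm{span}\{\mathbf 1\}$, $-\mathbf I_N\preceq\mathbf W\preceq\mathbf I_N$, $W_{ij}=0$ if $i\neq j$ and $(i,j)\notin\mathcal E$, and $W_{ij}>0$ otherwise. ''Diverges to infinity'' means $\|\mathbf x^r\|\to\infty$ as $r\to\infty$. *)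

(* Defs.v *)
From mathcomp Require Import all_boot all_order all_algebra.
From mathcomp Require Import all_classical all_reals all_analysis.

Set Implicit Arguments.
Unset Strict Implicit.
Unset Printing Implicit Defensive.

Import Order.TTheory GRing.Theory Num.Theory.
Import numFieldNormedType.Exports.

Local Open Scope classical_set_scope.
Local Open Scope ring_scope.

Definition undirected_graph (N : nat) (E : rel 'I_N) : Prop :=
  symmetric E /\ irreflexive E.

Definition connected_graph (N : nat) (E : rel 'I_N) : Prop :=
  forall i j : 'I_N, connect E i j.

(* The norm that the library puts on 'cV[R]_N is the max norm. *)
Definition euclid_norm (R : realType) (N : nat) (x : 'cV[R]_N) : R :=
  Num.sqrt (\sum_(i < N) x i 0 ^+ 2).

Definition psd (R : realType) (N : nat) (A : 'M[R]_N) : Prop :=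
  forall x : 'cV[R]_N, 0 <= (x^T *m A *m x) 0 0.

(* [loewner_le A B] is used for symmetric A and B only, so [psd] does not
   require symmetry. *)
Definition loewner_le (R : realType) (N : nat) (A B : 'M[R]_N) : Prop :=
  psd (B - A).

(* The diagonal entries of a mixing matrix are positive: only the entries
   W i j with i != j and (i, j) not an edge vanish. *)
Record mixing_matrix (R : realType) (N : nat) (E : rel 'I_N) (W : 'M[R]_N)
    : Prop := MixingMatrix {
  mixing_sym : W^T = W ;
  mixing_null : forall x : 'cV[R]_N,
    (1%:M - W) *m x = 0 <-> exists c : R, x = c *: const_mx 1 ;
  mixing_ge : loewner_le (- 1%:M) W ;
  mixing_le : loewner_le W 1%:M ;
  mixing_eq0 : forall i j : 'I_N, i != j -> ~~ E i j -> W i j = 0 ;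
  mixing_gt0 : forall i j : 'I_N, (i == j) || E i j -> 0 < W i j }.

Definition continuously_differentiable (R : realType) (h : R -> R) : Prop :=
  (forall u : R, derivable h u 1) /\ continuous (derive1 h).

Definition average (R : realType) (N : nat) (f : 'I_N -> R -> R) : R -> R :=
  fun u => N%:R^-1 * \sum_(i < N) f i u.

Definition GLC (R : realType) (h : R -> R) : Prop :=
  exists2 L : R, 0 < L &
    forall y z : R, `|derive1 h y - derive1 h z| <= L * `|y - z|.

Definition grad_g (R : realType) (N : nat) (f : 'I_N -> R -> R)
    (x : 'cV[R]_N) : 'cV[R]_N :=
  \col_(i < N) derive1 (f i) (x i 0).

Fixpoint dgd (R : realType) (N : nat) (f : 'I_N -> R -> R) (W : 'M[R]_N)
    (alpha : nat -> R) (x0 : 'cV[R]_N) (r : nat) : 'cV[R]_N :=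
  if r is r'.+1 then
    let x := dgd f W alpha x0 r' in W *m x - alpha r' *: grad_g f x
  else x0.

Definition diverges_to_infinity (R : realType) (N : nat)
    (x : nat -> 'cV[R]_N) : Prop :=
  euclid_norm (x r) @[r --> \oo] --> +oo.

(* Main.v *)
Require Import Defs.
From mathcomp Require Import all_boot all_order all_algebra.
From mathcomp Require Import all_classical all_reals all_analysis.
From mathcomp Require Import ring lra.
Import Order.TTheory GRing.Theory Num.Theory.
Import numFieldNormedType.Exports.
Local Open Scope ring_scope.

(** GLC constrains only the average, so opposite superlinear gradients may
    cancel in it.  Take two adjacent agents with [f_0 u = u ^+ 3 / 3] and
    [f_1 = - f_0]: the average is 0, while the individual gradients are
    quadratic.  With all four weights equal to 1/2, averaging kills the
    disagreement direction d = (1, -1), and, [u ^+ 2] being even, the gradient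
    at t *: d is t ^+ 2 *: d.  The line spanned by d is thus invariant, and DGD
    acts on it by t |-> - a_r t ^+ 2 with a_r the stepsize of round r
    ([dgd_disagreement]).  Starting at t = 2 / alpha, an induction gives
    |t_r| >= 2 (r + 1) / alpha as soon as a_r >= alpha / (1 + r)
    ([orbit_ge]); this lower bound on the stepsize covers the constant and the
    diminishing regimes at once. *)

Definition cubic (R : realType) (i : 'I_2) (u : R) : R :=
  (-1) ^+ i * (u ^+ 3 / 3).

Definition adjacent (i j : 'I_2) : bool := i != j.

Definition averaging (R : realType) : 'M[R]_2 := const_mx 2^-1.

Definition disagreement (R : realType) : 'cV[R]_2 := \col_i (-1) ^+ i.

Section Counterexample.
Variable R : realType.

Lemma is_derive_cubic (i : 'I_2) (u : R) :
  is_derive u 1 (@cubic R i) ((-1) ^+ i * u ^+ 2).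
Proof.
rewrite /cubic.
apply: is_derive_eq.
by rewrite !scaler1 /GRing.scale /=; field.
Qed.

Lemma derive1_cubic (i : 'I_2) (u : R) :
  derive1 (@cubic R i) u = (-1) ^+ i * u ^+ 2.
Proof. by rewrite derive1E; have [_ ->] := is_derive_cubic i u. Qed.

Lemma continuously_differentiable_cubic (i : 'I_2) :
  continuously_differentiable (@cubic R i).
Proof.
split=> [u|]; first by have [] := is_derive_cubic i u.
have -> : derive1 (@cubic R i) = (fun u => (-1) ^+ i * u ^+ 2).
  by apply/funext => u; exact: derive1_cubic.
by move=> u; apply: cvgMr; exact: exprn_continuous.
Qed.

Lemma GLC_average_cubic : GLC (average (@cubic R)).
Proof.
have -> : average (@cubic R) = cst 0.
  by apply/funext => u; rewrite /average /cubic !big_ord_recl big_ord0 /=; ring.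
by exists 1 => // y z; rewrite !derive1_cst subrr normr0 mul1r.
Qed.

Lemma connected_adjacent : connected_graph adjacent.
Proof.
move=> i j; have [->|neq_ij] := eqVneq i j; first exact: connect0.
exact: connect1.
Qed.

Lemma mixing_averaging : mixing_matrix adjacent (averaging R).
Proof.
split.
- exact: trmx_const.
- move=> x; split=> [/matrixP/(_ 0 0)|[c ->]].
  + rewrite !mxE !big_ord_recl big_ord0 !mxE /= => eq0.
    exists (x ord0 0); apply/matrixP => i j; rewrite (ord1 j) !mxE mulr1.
    case: i => -[|[|//]] lt_i2; first by congr (x _ _); exact: val_inj.
    rewrite (_ : Ordinal lt_i2 = lift ord0 ord0); last exact: val_inj.
    by move: eq0; lra.
  + apply/matrixP => i j; rewrite !mxE !big_ord_recl big_ord0 !mxE.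
    by case: i => -[|[|//]] lt_i2 /=; field.
- move=> x; rewrite !mxE !big_ord_recl big_ord0 !mxE /=.
  rewrite !big_ord_recl !big_ord0 !mxE /=.
  (* The quadratic form of W is (a + b)^2 / 2. *)
  set a : R := x _ _; set b : R := x _ _; have := sqr_ge0 (a + b); nra.
- move=> x; rewrite !mxE !big_ord_recl big_ord0 !mxE /=.
  rewrite !big_ord_recl !big_ord0 !mxE /=.
  (* The quadratic form of I - W is (a - b)^2 / 2. *)
  set a : R := x _ _; set b : R := x _ _; have := sqr_ge0 (a - b); nra.
- by move=> i j neq_ij; rewrite /adjacent neq_ij.
- by move=> i j _; rewrite mxE invr_gt0 ltr0n.
Qed.

Fixpoint orbit (a : nat -> R) (t : R) (r : nat) : R :=
  if r is r'.+1 then - (a r' * orbit a t r' ^+ 2) else t.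

Lemma averaging_disagreement : averaging R *m disagreement R = 0.
Proof.
by apply/matrixP => i j; rewrite !mxE !big_ord_recl big_ord0 !mxE /=; ring.
Qed.

(** Squaring erases the signs of the coordinates, and the opposite signs of the
    two gradients put them back. *)
Lemma grad_g_disagreement (t : R) :
  grad_g (@cubic R) (t *: disagreement R) = t ^+ 2 *: disagreement R.
Proof.
apply/matrixP => i j.
by rewrite !mxE derive1_cubic exprMn sqrr_sign mulr1 mulrC.
Qed.

Lemma dgd_disagreement (a : nat -> R) (t : R) (r : nat) :
  dgd (@cubic R) (averaging R) a (t *: disagreement R) r =
  orbit a t r *: disagreement R.
Proof.
elim: r => [//|r /= ->].
rewrite grad_g_disagreement -scalemxAr averaging_disagreement scaler0 sub0r.
by rewrite scalerA scaleNr.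
Qed.

(** The factor 2 makes the bound inductive: one round maps any t with
    |t| >= 2 (r + 1) / alpha to a point of modulus at least 4 (r + 1) / alpha,
    hence at least 2 (r + 2) / alpha. *)
Lemma orbit_ge (alpha : R) (a : nat -> R) (r : nat) :
  0 < alpha -> (forall r, alpha / (1 + r%:R) <= a r) ->
  2 / alpha * r.+1%:R <= `|orbit a (2 / alpha) r|.
Proof.
move=> alpha_gt0 age; elim: r => [|r IHr] /=.
  by rewrite mulr1 ler_norm.
have r1_gt0 : 0 < 1 + r%:R :> R by rewrite nat1r ltr0n.
rewrite normrN normrM normrX.
have a_ge0 : 0 <= a r by rewrite (le_trans _ (age r)) // divr_ge0 ?ltW.
rewrite (ger0_norm a_ge0).
apply: (@le_trans _ _ (alpha / (1 + r%:R) * (2 / alpha * r.+1%:R) ^+ 2)).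
  have -> : alpha / (1 + r%:R) * (2 / alpha * r.+1%:R) ^+ 2 =
            2 / alpha * (2 * (1 + r%:R)).
    by rewrite -nat1r; field; rewrite !gt_eqF.
  rewrite ler_pM2l ?divr_gt0 //.
  by rewrite -!nat1r; have := ler0n R r; lra.
apply: ler_pM => //.
- by rewrite divr_ge0 ?ltW.
- exact: sqr_ge0.
- by rewrite lerXn2r // ?nnegrE ?normr_ge0 ?mulr_ge0 ?ler0n ?invr_ge0 ?ltW.
Qed.

Lemma coord_le_euclid_norm (N : nat) (x : 'cV[R]_N) (i : 'I_N) :
  `|x i 0| <= euclid_norm x.
Proof.
rewrite -sqrtr_sqr ler_wsqrtr // (bigD1 i) //= lerDl sumr_ge0 // => j _.
exact: sqr_ge0.
Qed.

Lemma dgd_diverges (alpha : R) (a : nat -> R) :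
  0 < alpha -> (forall r, alpha / (1 + r%:R) <= a r) ->
  diverges_to_infinity
    (dgd (@cubic R) (averaging R) a ((2 / alpha) *: disagreement R)).
Proof.
move=> alpha_gt0 age.
apply: (@ger_cvgy _ _ _ _ (fun r => 2 / alpha * r.+1%:R)).
  apply: nearW => r; apply: le_trans (coord_le_euclid_norm _ _ ord0).
  by rewrite dgd_disagreement !mxE mulr1 orbit_ge.
apply: (@gt0_cvgMry R (r.+1%:R @[r --> \oo])%classic _ (2 / alpha) id).
  by rewrite divr_gt0.
by rewrite (cvg_shiftS (fun r => r%:R : R)); exact: cvgr_idn.
Qed.

End Counterexample.

Theorem claim1 (R : realType) :
  exists (N : nat) (E : rel 'I_N) (f : 'I_N -> R -> R) (W : 'M[R]_N),
    (0 < N)%N /\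
    undirected_graph E /\
    connected_graph E /\
    (forall i : 'I_N, continuously_differentiable (f i)) /\
    GLC (average f) /\
    mixing_matrix E W /\
    (forall alpha : R, 0 < alpha ->
      exists x0 : 'cV[R]_N,
        diverges_to_infinity (dgd f W (fun _ => alpha) x0)) /\
    (forall alpha : R, 0 < alpha ->
      exists x0 : 'cV[R]_N,
        diverges_to_infinity (dgd f W (fun r => alpha / (1 + r%:R)) x0)).
Proof.
exists 2, adjacent, (@cubic R), (averaging R).
split=> //; split.
  by split=> [i j|i]; rewrite /adjacent ?eqxx // eq_sym.
split; first exact: connected_adjacent.
split; first exact: continuously_differentiable_cubic.
split; first exact: GLC_average_cubic.
split; first exact: mixing_averaging.
split=> alpha alpha_gt0; exists ((2 / alpha) *: disagreement R);
  apply: dgd_diverges => // r.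
by rewrite ler_pdivrMr ?nat1r ?ltr0n // ler_peMr ?ler1n // ltW.
Qed.
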